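(* For every numerical semigroup $S\ne\mathbb{N}$, $$g(S)+\sigma(S)\;\le\;e(S)-1+t(S)\bigl(n(S)-1\bigr).$$ In particular $g(S)\le e(S)-1+t(S)\bigl(n(S)-1\bigr)$, and this bound is strictly stronger than the bound $g(S)\le t(S)\,n(S)$ (that is, $e(S)-1+t(S)(n(S)-1)<t(S)\,n(S)$) if and only if $t(S)\ge e(S)$.
   Context: $\mathbb{N}=\{0,1,2,\dots\}$. A numerical semigroup is a submonoid $S\subseteq\mathbb{N}$ (under addition) with finite complement $G(S)=\mathbb{N}\setminus S$. Let $S\ne\mathbb{N}$. $g(S)=|G(S)|$ is the genus, $F=\max G(S)$, $c(S)=F+1$, $n(S)=|S\cap[0,c(S))|$, and $e(S)$ is the cardinality of the unique minimal system of generators of $S$. An integer $f$ is a pseudo-Frobenius number if $f\notin S$ and $f+s\in S$ for all $s\in S\setminus\{0\}$; $\mathrm{PF}(S)$ is the set of these and $t(S)=|\mathrm{PF}(S)|$. Define $\sigma(S)=\sum_{f\in\mathrm{PF}(S)}|S\cap(f,F]|$. *)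

(* Defs.v *)
From mathcomp Require Import all_boot all_order all_algebra.
From mathcomp Require Import finmap.
From mathcomp Require Import boolp classical_sets functions cardinality set_interval.

Set Implicit Arguments.
Unset Strict Implicit.
Unset Printing Implicit Defensive.

Import Order.TTheory GRing.Theory Num.Theory.

Local Open Scope classical_set_scope.
Local Open Scope ring_scope.

(* [fset_set A] is [fset0] when [A] is infinite, so this is the cardinality
   for finite sets only; every set it is applied to below is finite when [S]
   is a numerical semigroup other than [setT]. *)
Definition setcard (T : choiceType) (A : set T) : nat := #|` fset_set A |%fset.

Definition submonoid (S : set nat) : Prop :=
  S 0%N /\ forall x y : nat, S x -> S y -> S (x + y)%N.

Definition gaps (S : set nat) : set nat := ~` S.

Definition numerical_semigroup (S : set nat) : Prop :=
  submonoid S /\ finite_set (gaps S).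

Definition genus (S : set nat) : nat := setcard (gaps S).

(* The value is 0 when there are no gaps, i.e. for the excluded [S = setT]. *)
Definition frobenius (S : set nat) : nat :=
  (\max_(x <- fset_set (gaps S)) x)%N.

Definition conductor (S : set nat) : nat := (frobenius S).+1.

Definition nleft (S : set nat) : nat := setcard (S `&` `I_(conductor S)).

Definition generates (A S : set nat) : Prop := smallest submonoid A = S.

Definition minimal_generators (S A : set nat) : Prop :=
  generates A S /\ forall B : set nat, B `<` A -> ~ generates B S.

(* [xget] selects the minimal system of generators, which exists and is unique
   for a numerical semigroup. *)
Definition embdim (S : set nat) : nat :=
  setcard (xget set0 [set A | minimal_generators S A]).

Definition toZ (S : set nat) : set int := [set s%:Z | s in S].

Definition PF (S : set nat) : set int :=
  [set f | ~ toZ S f /\ forall s : int, toZ S s -> s <> 0 -> toZ S (f + s)].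

Definition semigroup_type (S : set nat) : nat := setcard (PF S).

Definition sigma (S : set nat) : nat :=
  (\sum_(f <- fset_set (PF S))
     setcard (toZ S `&` `]f, (frobenius S)%:Z]%classic))%N.

(* Main.v *)
(** Join each pseudo-Frobenius number [f] to the gaps [f - s], for [s] in [S] with
    [s <= f]. This bipartite graph has [g + t] vertices, and [t n - sigma] edges,
    since the excluded pairs [(f, s)] with [f < s <= F] are counted by [sigma].
    Let [m] be the multiplicity. Every gap lies below a pseudo-Frobenius number,
    so two gaps differing by an element of [S] are connected; going up by [m] and
    then splitting Apery elements, every vertex is connected to some [a - m] with
    [a <> m] a minimal generator. Hence there are at most [e - 1] components, and
    a graph has at most as many vertices as edges and components together. *)
Require Import Defs.
From mathcomp Require Import all_boot all_order all_algebra finmap zify.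
From mathcomp Require Import boolp classical_sets cardinality.

Local Open Scope ring_scope.

(* A graph with edges [E] all of whose components meet [root] has at most
   [#|E| + #|K|] vertices: a 2-colouring is determined by its differences along
   the edges and its values at the roots. *)
Lemma card_le_rigid (V E K : finType) (src tgt : E -> V) (root : K -> V) :
    (forall phi : V -> bool, (forall e, phi (src e) = phi (tgt e)) ->
       (forall k, phi (root k) = false) -> forall v, phi v = false) ->
  (#|V| <= #|E| + #|K|)%N.
Proof.
move=> rigid.
pose d (phi : {ffun V -> bool}) : {ffun (E + K)%type -> bool} :=
  [ffun z => match z with
             | inl e => phi (src e) (+) phi (tgt e)
             | inr k => phi (root k)
             end].
have d_inj : injective d.
  move=> phi psi eq_d; apply/ffunP => v; apply/eqP; rewrite -negb_add.
  (* If [d phi = d psi], then the exclusive or of [phi] and [psi] is constant along edges and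
     vanishes at the roots. *)
  apply/negbT; apply: (rigid (fun v => phi v (+) psi v)) => [e|k].
    move/ffunP/(_ (inl e)): eq_d; rewrite !ffunE.
    by case: (phi _); case: (phi _); case: (psi _); case: (psi _).
  by move/ffunP/(_ (inr k)): eq_d; rewrite !ffunE => ->; rewrite addbb.
have := leq_card d d_inj.
by rewrite !card_ffun card_bool leq_exp2l // card_sum.
Qed.

(** * Finite sets and the embedding of naturals in the integers *)

Lemma bigmax_mem (s : seq nat) : s <> [::] -> (\max_(x <- s) x)%N \in s.
Proof.
elim: s => // x [|y s] IHs _; first by rewrite big_seq1 mem_head.
rewrite big_cons inE; case: leqP => _; last by rewrite eqxx.
by rewrite IHs ?orbT.
Qed.

Lemma mem_fset_setP (T : choiceType) (A : set T) (x : T) :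
  finite_set A -> reflect (A x) (x \in fset_set A).
Proof. by move=> finA; rewrite in_fset_set //; apply: (iffP idP) => /[!inE]. Qed.

Lemma setcardU (T : choiceType) (A B : set T) :
    finite_set A -> finite_set B -> (forall x, A x -> ~ B x) ->
  setcard (A `|` B)%classic = (setcard A + setcard B)%N.
Proof.
move=> finA finB disAB; rewrite /setcard fset_setU // cardfsU.
suff -> : (fset_set A `&` fset_set B = fset0)%fset by rewrite cardfs0 subn0.
apply/fsetP => x; rewrite in_fsetI [RHS]inE; apply/negP.
by move=> /andP[/mem_fset_setP-/(_ finA) Ax /mem_fset_setP-/(_ finB)]; apply: disAB.
Qed.

Lemma finite_ltn (A : set nat) (n : nat) :
  (forall x, A x -> (x < n)%N) -> finite_set A.
Proof. by move=> ltAn; apply: sub_finite_set (finite_II n) => x /ltAn. Qed.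

Lemma toZP (A : set nat) (n : nat) : toZ A n%:Z <-> A n.
Proof. by split=> [[m Am [<-]]|An] //; exists n. Qed.

Lemma setcard_toZ (A : set nat) : finite_set A -> setcard (toZ A) = setcard A.
Proof.
by move=> finA; rewrite /setcard fset_set_image // card_imfset // => ? ? [].
Qed.

Lemma sum_toZ (A : set nat) (G : int -> nat) : finite_set A ->
  (\sum_(f <- fset_set (toZ A)) G f = \sum_(f <- fset_set A) G f%:Z)%N.
Proof.
by move=> finA; rewrite fset_set_image // big_imfset //= => ? ? _ _ [].
Qed.

(** * Gaps, the Frobenius number and pseudo-Frobenius numbers *)

Definition pseudo_frobenius (S : set nat) : set nat :=
  [set f | ~ S f /\ forall s, S s -> s <> 0%N -> S (f + s)%N]%classic.

(** The irreducible elements of [S]; [embdim_atoms] identifies them with the minimal system of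
    generators. *)
Definition atoms (S : set nat) : set nat :=
  [set a | [/\ S a, a <> 0%N & forall x y, S x -> S y ->
              x <> 0%N -> y <> 0%N -> a <> (x + y)%N]]%classic.

Lemma gap_frobenius (S : set nat) : numerical_semigroup S ->
  S <> [set: nat]%classic -> ~ S (frobenius S).
Proof.
move=> [_ fing] neST; apply/(mem_fset_setP _ (gaps S)) => //; apply: bigmax_mem.
move=> gaps0; apply: neST; apply/seteqP; split=> // x _; apply: contrapT => gx.
have : x \in enum_fset (fset_set (gaps S)) by
  exact: introT (mem_fset_setP _ _ x fing) gx.
by rewrite gaps0.
Qed.

Lemma gt_frobenius (S : set nat) (x : nat) : numerical_semigroup S ->
  (frobenius S < x)%N -> S x.
Proof.
move=> [_ fing] ltFx; apply: contrapT => /(mem_fset_setP _ (gaps S) x fing) gx.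
by move: ltFx; rewrite ltnNge (@leq_bigmax_seq _ _ xpredT id).
Qed.

Lemma gap_le_frobenius (S : set nat) (x : nat) : numerical_semigroup S ->
  ~ S x -> (x <= frobenius S)%N.
Proof. by move=> nsS gx; rewrite leqNgt; apply/negP => /gt_frobenius-/(_ nsS). Qed.

Lemma PF_toZ (S : set nat) : numerical_semigroup S ->
  S <> [set: nat]%classic -> PF S = toZ (pseudo_frobenius S).
Proof.
move=> nsS neST; have gF := gap_frobenius _ nsS neST.
have S0 : S 0%N by case: nsS => -[].
apply/seteqP; split=> [[f|k] [nSf fP]|_ [f [nSf fP] <-]].
- exists f => //; split=> [Sf|s Ss s0]; first by apply/nSf/toZP.
  by apply/toZP; rewrite PoszD; apply: fP; [apply/toZP | case].
(* A negative [f = -(k+1)] is impossible: [F + k + 1] exceeds [F], so it lies in [S], and adding it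
   to [f] would put [F] in [S]. *)
- case: gF; apply/toZP.
  have -> : (frobenius S)%:Z = Negz k + (frobenius S + k.+1)%N%:Z.
    by rewrite NegzE; lia.
  apply: fP; last by rewrite addnS.
  by apply/toZP; apply: gt_frobenius => //; lia.
split=> [/toZP //|_ [s Ss <-] s0].
by rewrite -PoszD; apply/toZP; apply: fP => // s0'; apply: s0; rewrite s0'.
Qed.

(** * Atoms and the embedding dimension *)

Lemma smallest_submonoid (A : set nat) : submonoid (smallest submonoid A).
Proof.
split=> [M [[M0 _] _] //|x y Ax Ay M MA].
by case: (MA) => -[_ MD] _; apply: MD; [apply: Ax | apply: Ay].
Qed.

Lemma generates_atoms (S : set nat) : submonoid S -> generates (atoms S) S.
Proof.
move=> smS; apply/seteqP; split; first by apply: smallest_sub => // a [].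
have [gen0 genD] := smallest_submonoid (atoms S).
elim/ltn_ind => x IHx Sx; have [->//|x0] := eqVneq x 0%N.
have [atx|] := pselect (atoms S x); first exact: sub_gen_smallest.
move=> natx; have [[y [z [Sy Sz y0 z0 xyz]]]|noyz] := pselect (exists y z,
    [/\ S y, S z, y <> 0%N, z <> 0%N & x = (y + z)%N]).
  by rewrite xyz; apply: genD; apply: IHx => //; lia.
case: natx; split=> // [|y z Sy Sz y0 z0 xyz]; first exact/eqP.
by apply: noyz; exists y, z.
Qed.

(** Removing an atom [a] from [S] leaves a submonoid, so a generating set that missed [a] would
    generate no more than that. *)
Lemma atoms_sub_generators (S A : set nat) : submonoid S -> generates A S ->
  (atoms S `<=` A)%classic.
Proof.
move=> [S0 SD] genA a [Sa a0 aP]; apply: contrapT => nAa.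
suff : (S `<=` [set x | S x /\ x <> a])%classic by case/(_ a Sa) => _; apply.
rewrite -[X in (X `<=` _)%classic]genA; apply: smallest_sub.
  split=> [|x y [Sx xa] [Sy ya]]; first by split=> // a0'; apply: a0.
  split; first exact: SD.
  have [->|/eqP x0] := eqVneq x 0%N; first by rewrite add0n.
  have [->|/eqP y0] := eqVneq y 0%N; first by rewrite addn0.
  by move=> xya; apply: (aP x y).
move=> x Ax; split=> [|xa]; last by apply: nAa; rewrite -xa.
by rewrite -genA; apply: sub_gen_smallest.
Qed.

(** The atoms generate [S] and lie in every generating set, hence they form the only minimal one. *)
Lemma embdim_atoms (S : set nat) : submonoid S -> embdim S = setcard (atoms S).
Proof.
move=> smS; have genS := generates_atoms _ smS.
rewrite /embdim (@xget_unique _ _ _ (atoms S)) //=.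
  by split=> // B [_ nAB] /(atoms_sub_generators _ _ smS).
move=> B [genB minB]; have AB := atoms_sub_generators _ _ smS genB.
by apply/seteqP; split=> //; apply: contrapT => nBA; case: (minB (atoms S)).
Qed.

Lemma multiplicity_exists (S : set nat) : numerical_semigroup S ->
  exists m, [/\ S m, (0 < m)%N & forall s, S s -> s <> 0%N -> (m <= s)%N].
Proof.
move=> nsS; have exm : exists m, `[< S m >] && (0 < m)%N.
  by exists (frobenius S).+1; rewrite andbT; apply/asboolP; apply: gt_frobenius.
case: (ex_minnP exm) => m /andP[/asboolP Sm m0] minm; exists m; split=> // s Ss s0.
by apply: minm; rewrite lt0n; apply/andP; split; [exact/asboolP | exact/eqP].
Qed.

Lemma finite_atoms (S : set nat) : numerical_semigroup S -> finite_set (atoms S).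
Proof.
move=> nsS; apply: (@finite_ltn _ (2 * (frobenius S).+1)) => a [Sa a0 aP].
rewrite ltnNge; apply/negP => le_a.
have SF x : (frobenius S < x)%N -> S x by apply: gt_frobenius.
(* From [2(F+1)] on, [a] is the sum of [F+1] and a number at least [F+1], both nonzero and in
   [S]. *)
apply: (aP (frobenius S).+1 (a - (frobenius S).+1)%N); try lia.
  by apply: SF.
by apply: SF; lia.
Qed.

Lemma atom_multiplicity (S : set nat) (m : nat) : S m -> (0 < m)%N ->
  (forall s, S s -> s <> 0%N -> (m <= s)%N) -> atoms S m.
Proof.
move=> Sm m0 minm; split=> // [|x y Sx Sy x0 y0 mxy]; first by lia.
by have := minm x Sx x0; lia.
Qed.

(** * The graph on gaps and pseudo-Frobenius numbers *)

Lemma gap_below_pseudo_frobenius (S : set nat) (x : nat) :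
    numerical_semigroup S -> ~ S x ->
  exists2 s, S s & pseudo_frobenius S (x + s)%N.
Proof.
move=> nsS; have [[S0 SD] _] := nsS.
(* Climb from gap to gap by nonzero elements of [S]. Gaps are at most [F], so the climb stops, and
   it can stop only at a pseudo-Frobenius number. *)
have [n] := ubnP (frobenius S - x)%N; elim: n x => // n IHn x ltn nSx.
have [pfx|npfx] := pselect (pseudo_frobenius S x).
  by exists 0%N; rewrite ?addn0.
have [s [Ss s0 nSxs]] : exists s, [/\ S s, s <> 0%N & ~ S (x + s)%N].
  apply: contrapT => nos; apply: npfx; split=> // s Ss s0.
  by apply: contrapT => nSxs; apply: nos; exists s.
have := gap_le_frobenius _ _ nsS nSxs => le_xsF.
have [|u Su pfxsu] := IHn (x + s)%N _ nSxs; first by lia.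
by exists (s + u)%N; [apply: SD | rewrite addnA].
Qed.

Lemma pseudo_frobenius_sub_gap (S : set nat) (f s : nat) : submonoid S ->
  pseudo_frobenius S f -> S s -> (s <= f)%N -> ~ S (f - s)%N.
Proof.
by move=> [_ SD] [nSf _] Ss lesf Sfs; apply: nSf; rewrite -(subnK lesf); apply: SD.
Qed.

(* The vertices are the gaps together with a second copy of the pseudo-Frobenius
   numbers, and the edges are the pairs [(f, s)] with [s] in [S] and [s <= f],
   joining [f] to the gap [f - s]. *)
Lemma gaps_pseudo_frobenius_graph (S : set nat) (m : nat) :
    numerical_semigroup S -> S m -> (0 < m)%N ->
    (forall s, S s -> s <> 0%N -> (m <= s)%N) ->
  (setcard (gaps S) + setcard (pseudo_frobenius S) <=
   \sum_(f <- fset_set (pseudo_frobenius S)) setcard (S `&` `I_f.+1)%classic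
   + setcard (atoms S `\ m)%classic)%N.
Proof.
move=> nsS Sm m0 minm; have [smS fing] := nsS; have [S0 SD] := smS.
have finP : finite_set (pseudo_frobenius S).
  by apply: sub_finite_set fing => f [].
have finL f : finite_set (S `&` `I_f.+1)%classic.
  by apply: (@finite_ltn _ f.+1) => x [].
have finA : finite_set (atoms S `\ m)%classic.
  by apply: sub_finite_set (finite_atoms _ nsS) => a [].
set G := fset_set (gaps S); set P := fset_set (pseudo_frobenius S).
pose L (f : P) := fset_set (S `&` `I_(val f).+1)%classic.
set K := fset_set (atoms S `\ m)%classic.
have gapP (x : G) : ~ S (val x) by apply/(mem_fset_setP _ (gaps S)): (valP x).
have mkgap x : ~ S x -> {y : G | val y = x}.
  by move=> /(mem_fset_setP _ (gaps S) x fing) Gx; exists [` Gx]%fset.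
have pfP (f : P) : pseudo_frobenius S (val f).
  by apply/(mem_fset_setP _ (pseudo_frobenius S)): (valP f).
have mkpf f : pseudo_frobenius S f -> {h : P | val h = f}.
  by move=> /(mem_fset_setP _ _ f finP) Pf; exists [` Pf]%fset.
have LP (f : P) (s : L f) : S (val s) /\ (val s <= val f)%N.
  by apply/(mem_fset_setP _ (S `&` `I_(val f).+1)%classic): (valP s).
have tgt (e : {f : P & L f}) : {y : G | val y = (val (tag e) - val (tagged e))%N}.
  by apply: mkgap; have [] := LP _ (tagged e); apply: pseudo_frobenius_sub_gap.
have atom_gap a : (atoms S `\ m)%classic a -> (m <= a)%N /\ ~ S (a - m)%N.
  move=> [[Sa a0 aP] am]; have lema := minm _ Sa a0; split=> // Sam.
  apply: (aP m (a - m)%N) => //; try lia.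
  by move=> am0; apply: am => /=; lia.
have root (a : K) : {y : G | (val y + m = val a)%N}.
  have [lema nSam] : (m <= val a)%N /\ ~ S (val a - m)%N.
    by apply: atom_gap; apply/(mem_fset_setP _ (atoms S `\ m)%classic): (valP a).
  by have [y yE] := mkgap _ nSam; exists y; rewrite yE subnK.
have := @card_le_rigid (G + P)%type {f : P & L f} K (fun e => inr (tag e))
  (fun e => inl (sval (tgt e))) (fun a => inl (sval (root a))).
rewrite card_sum card_tagged sumnE big_map big_enum /=.
rewrite /setcard -/G -/P -/K !cardfE big_seq_fsetE /=.
under [X in _ -> (_ <= X + _)%N]eq_bigr => f _ do rewrite cardfE.
apply=> phi phi_edge phi_root.
have phi_pf (f : P) (y : G) s : S s -> (val y + s = val f)%N ->
    phi (inr f) = phi (inl y).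
  move=> Ss ysf; have Lfs : s \in L f.
    by apply/mem_fset_setP => //; split=> //; rewrite /= ltnS -ysf leq_addl.
  rewrite (phi_edge (Tagged _ [` Lfs]%fset)) /=.
  case: (tgt _) => /= z zE; congr (phi (inl _)); apply: val_inj.
  by rewrite /= zE -ysf addnK.
(* A pseudo-Frobenius number above [y] is also above [x], hence adjacent to both gaps. *)
have phi_le (x y : G) s : S s -> (val x + s = val y)%N ->
    phi (inl x) = phi (inl y).
  move=> Ss xsy; have [u Su /mkpf[f fE]] := gap_below_pseudo_frobenius _ _ nsS (gapP y).
  rewrite -(phi_pf f y u) // -(phi_pf f x (s + u)%N) //; first exact: SD.
  by rewrite addnA xsy.
(* These are the gaps [w - m] with [w] in the Apery set of [m]: when [w = s + u],
   the gap [s - m] lies below [w - m]. *)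
have phi_apery w (x : G) : S w -> (val x + m = w)%N -> phi (inl x) = false.
  elim/ltn_ind: w x => w IHw x Sw xmw.
  have x0 : val x <> 0%N by move=> x0; apply: (gapP x); rewrite x0.
  have [atw|natw] := pselect (atoms S w).
    (* The gap [x] is nonzero, so [w = x + m] differs from [m] and [x] is the root attached to
       [w]. *)
    have Kw : w \in K by apply/mem_fset_setP => //; split=> //= wm; lia.
    rewrite -(phi_root [` Kw]%fset); case: (root _) => /= y yE.
    by congr (phi (inl _)); apply: val_inj; apply: (@addIn m); exact: etrans xmw (esym yE).
  have [s [u [Ss Su s0 u0 wsu]]] : exists s u,
      [/\ S s, S u, s <> 0%N, u <> 0%N & w = (s + u)%N].
    apply: contrapT => nosu; apply: natw; split=> // [|s u Ss Su s0 u0 wsu].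
      by lia.
    by apply: nosu; exists s, u.
  have lems := minm _ Ss s0.
  have [|y yE] := mkgap (s - m)%N.
    have xE : val x = (s - m + u)%N by lia.
    by move=> Ssm; apply: (gapP x); rewrite xE; apply: SD.
  rewrite -(phi_le y x u) //; last by lia.
  by apply: (IHw s) => //; lia.
have phi_gap (x : G) : phi (inl x) = false.
  (* Add [m] repeatedly until [x + m] lies in [S], where [phi_apery] applies. *)
  have [n] := ubnP (frobenius S - val x)%N; elim: n x => // n IHn x ltn.
  have [Sxm|nSxm] := pselect (S (val x + m)%N); first exact: phi_apery Sxm _.
  have [y yE] := mkgap _ nSxm.
  rewrite (phi_le x y m) //; apply: IHn.
  by have := gap_le_frobenius _ _ nsS nSxm; lia.
(* The edge [(f, 0)] joins [f] to its own copy among the gaps. *)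
move=> [//|f]; have [y yE] := mkgap _ (proj1 (pfP f)).
by rewrite (phi_pf f y 0%N) // addn0.
Qed.

(** * Counting the edges, and the final bound *)

Lemma pairs_count (S : set nat) : numerical_semigroup S ->
    S <> [set: nat]%classic ->
  ((\sum_(f <- fset_set (pseudo_frobenius S)) setcard (S `&` `I_f.+1)%classic)
   + sigma S = semigroup_type S * nleft S)%N.
Proof.
move=> nsS neST; have [_ fing] := nsS.
have finP : finite_set (pseudo_frobenius S).
  by apply: sub_finite_set fing => f [].
rewrite /sigma /semigroup_type PF_toZ // sum_toZ // setcard_toZ // -big_split /=.
rewrite [X in (X * _)%N]/setcard card_fset_sum1 big_distrl /=; apply: eq_big_seq => f.
move=> /mem_fset_setP-/(_ finP)[nSf _]; rewrite mul1n.
have lefF := gap_le_frobenius _ _ nsS nSf.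
(* The elements of [S] up to [F] split at [f]: those up to [f] give the edges at [f], and those in
   [B] give its term in [sigma]. *)
pose B := [set s | S s /\ (f < s <= frobenius S)%N]%classic.
have finB : finite_set B by apply: (@finite_ltn _ (frobenius S).+1) => s [_]; lia.
have -> : (toZ S `&` `]f%:Z, (frobenius S)%:Z]%classic)%classic = toZ B.
  apply/seteqP; split=> [_ [[s Ss <-]]|_ [s [Ss sP] <-]] /=.
    by rewrite in_itv /= => sP; apply/toZP; split=> //; lia.
  by split; [apply/toZP | rewrite /= in_itv /=; lia].
rewrite setcard_toZ // -setcardU //; last first.
- by move=> x [_ /=] ltx [_]; lia.
- by apply: (@finite_ltn _ f.+1) => x [].
congr setcard; apply/seteqP; split=> s /=.
  by move=> [[Ss ltsf]|[Ss sP]]; split=> //; rewrite /conductor /=; lia.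
move=> [Ss]; rewrite /conductor => ltsF.
by case: (leqP s f) => lesf; [left | right; split => //; lia].
Qed.

Theorem corollary4p8 (S : set nat) (hS : numerical_semigroup S)
    (hN : S <> [set: nat]%classic) :
  [/\ (genus S)%:Z + (sigma S)%:Z
        <= (embdim S)%:Z - 1 + (semigroup_type S)%:Z * ((nleft S)%:Z - 1),
      (genus S)%:Z <= (embdim S)%:Z - 1 + (semigroup_type S)%:Z * ((nleft S)%:Z - 1)
    & ((embdim S)%:Z - 1 + (semigroup_type S)%:Z * ((nleft S)%:Z - 1)
         < (semigroup_type S)%:Z * (nleft S)%:Z)
      <-> (embdim S <= semigroup_type S)%N].
Proof.
have [smS _] := hS; have [m [Sm m0 minm]] := multiplicity_exists _ hS.
have graph := gaps_pseudo_frobenius_graph _ _ hS Sm m0 minm.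
have pairs := pairs_count _ hS hN.
(* The multiplicity [m] is itself an atom, so there are [e - 1] roots. *)
have embdimE : embdim S = (setcard (atoms S `\ m)%classic).+1.
  rewrite embdim_atoms // -[X in setcard X](@setD1K _ m); last first.
    exact: atom_multiplicity.
  rewrite setcardU ?/setcard ?fset_set1 ?cardfs1 //.
  - by apply: sub_finite_set (finite_atoms _ hS) => a [].
  - by move=> x xm [_ /(_ xm)].
have typeE : semigroup_type S = setcard (pseudo_frobenius S).
  rewrite /semigroup_type PF_toZ // setcard_toZ //.
  by case: hS => _; apply: sub_finite_set => f [].
have bound : (genus S + sigma S + semigroup_type S + 1
              <= embdim S + semigroup_type S * nleft S)%N.
  by rewrite -pairs embdimE typeE /genus; lia.
have boundZ : (genus S)%:Z + (sigma S)%:Z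
    <= (embdim S)%:Z - 1 + (semigroup_type S)%:Z * ((nleft S)%:Z - 1).
  by rewrite GRing.mulrBr GRing.mulr1 -PoszM; lia.
(* The new bound minus [t n] equals [e - 1 - t], which is negative exactly when [e <= t]. *)
by split=> //; [lia | rewrite GRing.mulrBr GRing.mulr1 -PoszM; split; lia].
Qed.
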